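(* Let $0<\epsilon<\frac{\sqrt2}{2}$ be a constant. There is a constant $c>0$ such that the following holds for every function $m=m(n)\ge 0$. Consider the fraction of matrices $\mathbf M\in\mathrm{GL}(n,2)$ with the following property: every $n$-qubit $m$-ancilla quantum circuit that $\epsilon$-approximates the CNOT circuit $\mathbf M$ has depth at least $$c\cdot\max\left\{\log n,\ \frac{n^2}{(n+m)\log(n+m)}\right\}.$$ This fraction tends to $1$ as $n\to\infty$.
   Context: Quantum circuits here consist of arbitrary single-qubit and two-qubit unitary gates. The depth of a circuit is the number of layers, where each layer consists of gates acting on pairwise disjoint qubits. A matrix $\mathbf M\in\mathrm{GL}(n,2)$ is identified with the $n$-qubit CNOT circuit $\mathcal C_1$ acting by $|\mathbf x\rangle\mapsto|\mathbf M\mathbf x\rangle$ on computational basis states. An $n$-qubit $m$-ancilla quantum circuit $\mathcal C_2$ is a circuit on $n+m$ qubits. It $\epsilon$-approximates $\mathcal C_1$ if for every $\mathbf x\in\{0,1\}^n$ two conditions hold: - $\mathcal C_2|\mathbf x\rangle|0\rangle^{\otimes m}=|\varphi_{\mathbf x}\rangle|0\rangle^{\otimes m}$ for some unit vector $|\varphi_{\mathbf x}\rangle\in\mathbb C^{2^n}$; - $\||\varphi_{\mathbf x}\rangle-\mathcal C_1|\mathbf x\rangle\|_2<\epsilon$. Logarithms are base 2. *)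

(* Defs.v *)
From Stdlib Require Import Reals ClassicalEpsilon.
From Stdlib Require List.
From HB Require Import structures.
From mathcomp Require Import all_boot all_order all_algebra.



Unset Printing Implicit Defensive.

Open Scope R_scope.

Record cplx := mkC { cre : R; cim : R }.
Definition C0 : cplx := mkC 0 0.
Definition C1 : cplx := mkC 1 0.
Definition Cadd (a b : cplx) := mkC (cre a + cre b) (cim a + cim b).
Definition Csub (a b : cplx) := mkC (cre a - cre b) (cim a - cim b).
Definition Cmul (a b : cplx) :=
  mkC (cre a * cre b - cim a * cim b) (cre a * cim b + cim a * cre b).
Definition Cconj (a : cplx) := mkC (cre a) (- cim a).
Definition Cnorm2 (a : cplx) : R := (cre a * cre a + cim a * cim a).

Fixpoint rsum (N : nat) (f : nat -> R) : R :=
  match N with O => 0 | S k => (rsum k f + f k) end.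

(* ---------- states on N qubits ----------
   A state is a function from basis indices k < 2^N to amplitudes;
   qubit i of basis state k is bit i of k (Nat.testbit k i). *)
Definition state := nat -> cplx.
Definition basis (k : nat) : state := fun j => if Nat.eqb j k then C1 else C0.
Definition setb (k q : nat) (b : bool) : nat :=
  if b then Nat.setbit k q else Nat.clearbit k q.

(* G1 q U : single-qubit unitary U (U out in) acting on qubit q;
   G2 q1 q2 U : two-qubit unitary U on ordered pair of qubits (q1,q2). *)
Inductive gate :=
| G1 (q : nat) (U : bool -> bool -> cplx)
| G2 (q1 q2 : nat) (U : bool * bool -> bool * bool -> cplx).

Definition bools := [:: false; true].
Definition bools2 := [:: (false,false); (false,true); (true,false); (true,true)].
Definition csum {T} (s : list T) (f : T -> cplx) : cplx :=
  List.fold_right (fun t acc => Cadd (f t) acc) C0 s.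

Definition unitary1 (U : bool -> bool -> cplx) : Prop :=
  forall a b, csum bools (fun o => Cmul (Cconj (U o a)) (U o b))
              = if a == b then C1 else C0.
Definition unitary2 (U : bool * bool -> bool * bool -> cplx) : Prop :=
  forall a b, csum bools2 (fun o => Cmul (Cconj (U o a)) (U o b))
              = if a == b then C1 else C0.

Definition gate_qubits (g : gate) : list nat :=
  match g with G1 q _ => [:: q] | G2 q1 q2 _ => [:: q1; q2] end.

Definition wf_gate (N : nat) (g : gate) : Prop :=
  match g with
  | G1 q U => (q < N)%nat /\ unitary1 U
  | G2 q1 q2 U => (q1 < N)%nat /\ (q2 < N)%nat /\ q1 <> q2 /\ unitary2 U
  end.

Definition apply_gate (g : gate) (psi : state) : state :=
  match g with
  | G1 q U => fun k =>
      csum bools (fun b => Cmul (U (Nat.testbit k q) b) (psi (setb k q b)))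
  | G2 q1 q2 U => fun k =>
      csum bools2 (fun b =>
        Cmul (U (Nat.testbit k q1, Nat.testbit k q2) b)
             (psi (setb (setb k q1 b.1) q2 b.2)))
  end.

Definition layer := list gate.
Definition wf_layer (N : nat) (L : layer) : Prop :=
  (forall g, List.In g L -> wf_gate N g) /\
  List.NoDup (List.flat_map gate_qubits L).
Definition apply_layer (L : layer) (psi : state) : state :=
  List.fold_left (fun ps g => apply_gate g ps) L psi.

Definition circuit := list layer.
Definition wf_circuit (N : nat) (Cc : circuit) : Prop :=
  forall L, List.In L Cc -> wf_layer N L.
Definition run (Cc : circuit) (psi : state) : state :=
  List.fold_left (fun ps L => apply_layer L ps) Cc psi.
Definition depth (Cc : circuit) : nat := List.length Cc.

Definition vec_of (n k : nat) : 'cV['F_2]_n :=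
  \col_(i < n) (if Nat.testbit k i then (GRing.one 'F_2) else (@GRing.zero 'F_2)).
Definition cnot_out (n : nat) (M : 'M['F_2]_n) (k : nat) : nat :=
  \sum_(i < n) (if (mulmx M (vec_of n k)) i ord0 != (@GRing.zero 'F_2) then 2 ^ i else 0)%nat.

(* The n-qubit m-ancilla circuit Cc eps-approximates the CNOT circuit M.
   Data qubits are 0..n-1, ancillas n..n+m-1, so |x>|0^m> is basis index x. *)
Definition approximates (n m : nat) (Cc : circuit) (M : 'M['F_2]_n) (eps : R)
  : Prop :=
  forall x : nat, (x < 2 ^ n)%nat ->
    exists phi : state,
      rsum (2 ^ n) (fun j => Cnorm2 (phi j)) = 1 /\
      (forall k, (k < 2 ^ (n + m))%nat ->
         run Cc (basis x) k = if (k < 2 ^ n)%nat then phi k else C0) /\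
      (sqrt (rsum (2 ^ n)
               (fun j => Cnorm2 (Csub (phi j) (basis (cnot_out n M x) j))))
        < eps).

Definition log2 (x : R) : R := (ln x / ln 2).

Definition depth_bound (c : R) (n m : nat) : R :=
  (c * Rmax (log2 (INR n))
            (INR n ^ 2 / (INR (n + m) * log2 (INR (n + m))))).

Definition hard (eps c : R) (n m : nat) (M : 'M['F_2]_n) : Prop :=
  forall Cc : circuit, wf_circuit (n + m) Cc -> approximates n m Cc M eps ->
    (INR (depth Cc) >= depth_bound c n m).

Definition pbool (P : Prop) : bool :=
  if excluded_middle_informative P then true else false.

Definition hard_fraction (eps c : R) (n m : nat) : R :=
  (INR #|[set M : 'M['F_2]_n | (M \in unitmx) && pbool (hard eps c n m M)]|
   / INR #|[set M : 'M['F_2]_n | M \in unitmx]|).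

(* Main.v *)
(** Two independent arguments bound the depth from below.

    Light cone: measuring output qubit i after a circuit of depth d is insensitive to the
    inputs outside a set of at most 2^d qubits, so row i of M has weight at most 2^d. If
    d < c log n, all rows have weight at most n^(1/4), and such matrices are exponentially
    rare in GL(n,2).

    Counting: round the gate entries of a circuit to multiples of 1/K with K ~ n^2. As
    2 eps < sqrt 2, two circuits of the same rounded shape with at most n^2 gates cannot
    approximate different matrices. With N = n + m, a circuit of depth d has at most d N
    gates, each with N^O(1) rounded shapes, so that d < c n^2 / (N log N) leaves at most
    2^(n^2/2) matrices, against |GL(n,2)| >= 2^(n(n-1)). *)

From Stdlib Require Import ZArith Reals Lra Lia FunctionalExtensionality ClassicalEpsilon.
From mathcomp Require Import all_boot all_order all_algebra zify.
Require Import Defs.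

Unset Printing Implicit Defensive.
(* [all_algebra] has taken over the key %R for [ring_scope]. *)
Delimit Scope R_scope with R.
Open Scope R_scope.

(** * Complex arithmetic and sums over lists *)

Lemma cplx_eq (a b : cplx) : cre a = cre b -> cim a = cim b -> a = b.
Proof. by case: a b => [ar ai] [br bi] /= -> ->. Qed.

Definition Copp (a : cplx) := mkC (- cre a) (- cim a).

Lemma cplx_ring : ring_theory C0 C1 Cadd Cmul Csub Copp eq.
Proof. by split => *; apply: cplx_eq => /=; ring. Qed.

Add Ring cplx_ring_instance : cplx_ring.

Lemma Cconj_add a b : Cconj (Cadd a b) = Cadd (Cconj a) (Cconj b).
Proof. by apply: cplx_eq => /=; ring. Qed.

Lemma Cconj_mul a b : Cconj (Cmul a b) = Cmul (Cconj a) (Cconj b).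
Proof. by apply: cplx_eq => /=; ring. Qed.

Lemma Cconj0 : Cconj C0 = C0.
Proof. by apply: cplx_eq => /=; ring. Qed.

(** Embeds the real squared modulus into [cplx], so that norm identities reduce to sums of complex
    products. *)
Lemma Cnorm2E a : mkC (Cnorm2 a) 0 = Cmul (Cconj a) a.
Proof. by rewrite /Cnorm2; apply: cplx_eq => /=; ring. Qed.

Lemma Cnorm2_ge0 a : 0 <= Cnorm2 a.
Proof. by rewrite /Cnorm2; nra. Qed.

Lemma Cnorm2_mul a b : Cnorm2 (Cmul a b) = Cnorm2 a * Cnorm2 b.
Proof. by rewrite /Cnorm2 /=; ring. Qed.

Section FiniteSums.
Context {T : Type}.
Implicit Types (s : list T) (f g : T -> cplx) (c : cplx).

Lemma csum_cons a s f : csum (a :: s) f = Cadd (f a) (csum s f).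
Proof. by []. Qed.

Lemma eq_csum s f g : (forall t, List.In t s -> f t = g t) -> csum s f = csum s g.
Proof.
elim: s => [//|a s IH] fg; rewrite !csum_cons fg; last by left.
by rewrite IH // => t ts; apply: fg; right.
Qed.

Lemma csum_add s f g : csum s (fun t => Cadd (f t) (g t)) = Cadd (csum s f) (csum s g).
Proof. elim: s => [|a s IH]; rewrite ?csum_cons ?IH /=; ring. Qed.

Lemma csum_mull s f c : Cmul c (csum s f) = csum s (fun t => Cmul c (f t)).
Proof. elim: s => [|a s IH]; rewrite ?csum_cons -?IH /=; ring. Qed.

Lemma csum_mulr s f c : Cmul (csum s f) c = csum s (fun t => Cmul (f t) c).
Proof. elim: s => [|a s IH]; rewrite ?csum_cons -?IH /=; ring. Qed.

Lemma csum_conj s f : Cconj (csum s f) = csum s (fun t => Cconj (f t)).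
Proof. by elim: s => [|a s IH]; rewrite ?csum_cons ?Cconj_add ?IH //= Cconj0. Qed.

Lemma csum0 s : csum s (fun _ => C0) = C0.
Proof. elim: s => [//|a s IH]; rewrite csum_cons IH; ring. Qed.

Definition lsum s (f : T -> R) : R := List.fold_right (fun t acc => f t + acc) 0 s.

Lemma eq_lsum s (f g : T -> R) : (forall t, List.In t s -> f t = g t) -> lsum s f = lsum s g.
Proof.
elim: s => [//|a s IH] fg /=; rewrite fg; last by left.
by rewrite IH // => t ts; apply: fg; right.
Qed.

Lemma lsum_le s (f g : T -> R) :
  (forall t, List.In t s -> f t <= g t) -> lsum s f <= lsum s g.
Proof.
elim: s => [|a s IH] fg /=; first lra.
apply: Rplus_le_compat; first by apply: fg; left.
by apply: IH => t ts; apply: fg; right.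
Qed.

Lemma lsum_mull s (f : T -> R) (c : R) : lsum s (fun t => c * f t) = c * lsum s f.
Proof. by elim: s => [|a s IH] /=; rewrite ?IH; lra. Qed.

Lemma lsum_ge s (f : T -> R) a :
  (forall t, 0 <= f t) -> List.In a s -> f a <= lsum s f.
Proof.
move=> f0; have g0 r : 0 <= lsum r f by elim: r => [|b r IH] /=; [lra|have := f0 b; lra].
elim: s => [//|b s IH] /= [->|/IH h]; first by have := g0 s; lra.
by have := f0 b; lra.
Qed.

Lemma csum_Cnorm2 s f : csum s (fun t => mkC (Cnorm2 (f t)) 0) = mkC (lsum s (fun t => Cnorm2 (f t))) 0.
Proof. by elim: s => [//|a s IH]; rewrite csum_cons IH; apply: cplx_eq => /=; lra. Qed.

(** Cauchy-Schwarz against the all-ones vector, one term at a time. *)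
Lemma Cnorm2_csum_le s f : Cnorm2 (csum s f) <= INR (length s) * lsum s (fun t => Cnorm2 (f t)).
Proof.
elim: s => [|a s IH]; first by rewrite /= /Cnorm2 /=; lra.
rewrite csum_cons [length _]/= S_INR /=.
set S := csum s f in IH *; set l := lsum s _ in IH *; set n := INR (length s) in IH *.
have n0 : 0 <= n by exact: pos_INR.
have l0 : 0 <= l.
  by rewrite /l; elim: (s) => [|b r IHr] /=; [lra|have := Cnorm2_ge0 (f b); lra].
have x0 := Cnorm2_ge0 (f a).
(* |x + y|^2 <= |x|^2 + |y|^2 + 2 |x| |y|, and (x.y)^2 <= |x|^2 n l <= ((n |x|^2 + l) / 2)^2 *)
have dot2 : (cre (f a) * cre S + cim (f a) * cim S)^2 <= Cnorm2 (f a) * Cnorm2 S.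
  rewrite /Cnorm2; set p := cre (f a); set q := cim (f a).
  by have := pow2_ge_0 (p * cim S - q * cre S); nra.
have {}dot2 : (2 * (cre (f a) * cre S + cim (f a) * cim S))^2 <= (n * Cnorm2 (f a) + l)^2.
  have := pow2_ge_0 (n * Cnorm2 (f a) - l); have := Rmult_le_compat_l _ _ _ x0 IH; nra.
have dot : 2 * (cre (f a) * cre S + cim (f a) * cim S) <= n * Cnorm2 (f a) + l.
  apply: Rnot_lt_le => lt; have : 0 <= n * Cnorm2 (f a) by nra.
  nra.
have -> : Cnorm2 (Cadd (f a) S) = Cnorm2 (f a) + Cnorm2 S + 2 * (cre (f a) * cre S + cim (f a) * cim S).
  by rewrite /Cnorm2 /=; ring.
by move: IH dot; lra.
Qed.

End FiniteSums.

Lemma csum_exchange {T U : Type} (s : list T) (r : list U) (f : T -> U -> cplx) :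
  csum s (fun t => csum r (f t)) = csum r (fun u => csum s (fun t => f t u)).
Proof. by elim: s => [|a s IH]; rewrite ?csum0 // csum_cons IH -csum_add. Qed.

(** * Sums over basis indices *)

Lemma eq_rsum N f g : (forall k, (k < N)%nat -> f k = g k) -> rsum N f = rsum N g.
Proof.
elim: N => [//|N IH] fg /=; rewrite IH ?fg // => k kN; apply: fg; lia.
Qed.

Lemma rsum_le N f g : (forall k, (k < N)%nat -> f k <= g k) -> rsum N f <= rsum N g.
Proof.
elim: N => [|N IH] fg /=; first lra.
by apply: Rplus_le_compat; [apply: IH => k kN; apply: fg; lia|apply: fg].
Qed.

Lemma rsum_add N f g : rsum N (fun k => f k + g k) = rsum N f + rsum N g.
Proof. by elim: N => [|N IH] /=; rewrite ?IH; lra. Qed.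

Lemma rsum_mull N f c : rsum N (fun k => c * f k) = c * rsum N f.
Proof. by elim: N => [|N IH] /=; rewrite ?IH; lra. Qed.

Lemma rsum_ge0 N f : (forall k, 0 <= f k) -> 0 <= rsum N f.
Proof. by move=> f0; elim: N => [|N IH] /=; [lra|have := f0 N; lra]. Qed.

Lemma rsum0 N f : (forall k, (k < N)%nat -> f k = 0) -> rsum N f = 0.
Proof.
move=> f0; rewrite (@eq_rsum _ _ (fun _ => 0 * 0)); first by rewrite rsum_mull; lra.
by move=> k /f0 ->; lra.
Qed.

Lemma rsum_single N f a : (a < N)%nat -> (forall k, k <> a -> f k = 0) -> rsum N f = f a.
Proof.
move=> aN f0; elim: N aN => [//|N IH] aN /=.
case: (Nat.eq_dec a N) => [<-|ne]; last by rewrite (f0 N) ?IH; [lra|lia|lia].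
by rewrite rsum0 => [|k kN]; [lra|apply: f0; lia].
Qed.

Lemma rsum_double N f : rsum (2 * N) f = rsum N (fun k => f (2 * k)%nat + f (2 * k + 1)%nat).
Proof.
elim: N => [//|N IH]; have -> : (2 * N.+1)%nat = (2 * N).+2 by lia.
rewrite /= IH; have -> : (2 * N).+1 = (2 * N + 1)%nat by lia.
by lra.
Qed.

Lemma rsum_split N M f : (forall k, (N <= k)%nat -> (k < M)%nat -> f k = 0) -> (N <= M)%nat ->
  rsum M f = rsum N f.
Proof.
elim: M => [|M IH] f0 NM; first by have -> : N = O by lia.
case: (Nat.eq_dec N M.+1) => [-> //|ne] /=; rewrite f0 ?IH; [lra| |lia|lia|lia].
by move=> k Nk kM; apply: f0; lia.
Qed.

(** * Gates *)

Lemma testbit_setb k q b q' :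
  Nat.testbit (setb k q b) q' = if Nat.eqb q q' then b else Nat.testbit k q'.
Proof.
by case: b; rewrite /setb ?Nat.setbit_eqb ?Nat.clearbit_eqb; case: (Nat.eqb q q'); rewrite ?andbF ?andbT.
Qed.

Lemma setb_comm k q b q' b' : q <> q' ->
  setb (setb k q b) q' b' = setb (setb k q' b') q b.
Proof.
move=> ne; apply: Nat.bits_inj => i; rewrite !testbit_setb.
by case: (Nat.eqb_spec q' i) => [<-|//]; case: Nat.eqb_spec.
Qed.

Lemma setb_setb k q b b' : setb (setb k q b) q b' = setb k q b'.
Proof. by apply: Nat.bits_inj => i; rewrite !testbit_setb; case: Nat.eqb. Qed.

Lemma testbit_double0 k (b : bool) : Nat.testbit (2 * k + b)%nat 0 = b.
Proof. by case: b; [exact: Nat.testbit_odd_0|rewrite addn0; exact: Nat.testbit_even_0]. Qed.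

Lemma testbit_doubleS k (b : bool) q : Nat.testbit (2 * k + b)%nat q.+1 = Nat.testbit k q.
Proof.
by case: b; [exact: Nat.testbit_odd_succ'|rewrite addn0; exact: Nat.testbit_even_succ'].
Qed.

Lemma setb_double0 k (b c : bool) : setb (2 * k + b)%nat 0 c = (2 * k + c)%nat.
Proof.
by apply: Nat.bits_inj => -[|i]; rewrite testbit_setb ?testbit_double0 ?testbit_doubleS.
Qed.

Lemma setb_doubleS k (b c : bool) q : setb (2 * k + b)%nat q.+1 c = (2 * setb k q c + b)%nat.
Proof.
apply: Nat.bits_inj => -[|i]; rewrite testbit_setb ?testbit_double0 ?testbit_doubleS //.
by rewrite testbit_setb.
Qed.

(** Overwriting qubit q makes every index appear twice. The induction on N splits off the lowest
    bit, which is the overwritten one when q = 0. *)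
Lemma rsum_setb N q F : (q < N)%nat ->
  rsum (2 ^ N) (fun k => F (setb k q false) + F (setb k q true)) = 2 * rsum (2 ^ N) F.
Proof.
elim: N q F => [//|N IH] [|q] F qN; rewrite expnS !rsum_double -rsum_mull.
  apply: eq_rsum => k _; have := setb_double0 k.
  move=> sd; move: (sd false false) (sd true false) (sd false true) (sd true true).
  by rewrite /= !addn0 => -> -> -> ->; lra.
rewrite rsum_mull -(IH q (fun k => F (2 * k)%nat + F (2 * k + 1)%nat)) //.
apply: eq_rsum => k _; have := setb_doubleS k.
move=> sd; move: (sd false false q) (sd true false q) (sd false true q) (sd true true q).
by rewrite /= !addn0 => -> -> -> ->; lra.
Qed.

(* A uniform description of one- and two-qubit gates: [rd g k] is the local
   configuration of the basis index k, and [wr g k b] overwrites it with b. *)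
Definition loc (g : gate) : list (bool * bool) :=
  match g with G1 _ _ => [:: (false, false); (true, false)] | G2 _ _ _ => bools2 end.
Definition mat (g : gate) : bool * bool -> bool * bool -> cplx :=
  match g with G1 _ U => fun a b => U a.1 b.1 | G2 _ _ U => U end.
Definition rd (g : gate) (k : nat) : bool * bool :=
  match g with
  | G1 q _ => (Nat.testbit k q, false)
  | G2 q1 q2 _ => (Nat.testbit k q1, Nat.testbit k q2)
  end.
Definition wr (g : gate) (k : nat) (b : bool * bool) : nat :=
  match g with
  | G1 q _ => setb k q b.1
  | G2 q1 q2 _ => setb (setb k q1 b.1) q2 b.2
  end.

Lemma apply_gateE g psi k :
  apply_gate g psi k = csum (loc g) (fun b => Cmul (mat g (rd g k) b) (psi (wr g k b))).
Proof. by case: g. Qed.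

Lemma rd_loc g k : List.In (rd g k) (loc g).
Proof. by case: g => [q U|q1 q2 U] /=; do 2?case: Nat.testbit; rewrite /=; tauto. Qed.

(** Membership in [loc g] fixes the dummy second bit of a single-qubit configuration to [false]. *)
Lemma rd_wr N g k b : wf_gate N g -> List.In b (loc g) -> rd g (wr g k b) = b.
Proof.
case: g => [q U|q1 q2 U] /=.
  by rewrite testbit_setb Nat.eqb_refl => _ [<-|[<-|[]]].
case=> _ [_ [ne _]] _; rewrite !testbit_setb !Nat.eqb_refl.
by case: Nat.eqb_spec => [e|_]; [case: ne|case: b].
Qed.

Lemma wr_wr N g k b c : wf_gate N g -> wr g (wr g k b) c = wr g k c.
Proof.
case: g => [q U|q1 q2 U] /=; first by rewrite setb_setb.
by case=> _ [_ [ne _]]; rewrite (setb_comm _ q2) ?setb_setb; last exact/nesym.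
Qed.

(** Each index equals [wr g k b] for exactly [length (loc g)] pairs (k, b). A two-qubit gate takes
    two rounds of [rsum_setb]. *)
Lemma rsum_wr N g F : wf_gate N g ->
  rsum (2 ^ N) (fun k => lsum (loc g) (fun b => F (wr g k b)))
  = INR (length (loc g)) * rsum (2 ^ N) F.
Proof.
case: g => [q U|q1 q2 U] /=.
  by case=> qN _; rewrite -(rsum_setb _ _ F qN); apply: eq_rsum => k _; rewrite /lsum /=; lra.
case=> q1N [q2N _].
have -> : 1 + 1 + 1 + 1 = 2 * 2 by lra.
rewrite Rmult_assoc -(rsum_setb _ _ F q2N).
rewrite -(rsum_setb _ _ (fun k => F (setb k q2 false) + F (setb k q2 true)) q1N).
by apply: eq_rsum => k _; rewrite /lsum /=; lra.
Qed.

Lemma wf_gate_unitary N g a b : wf_gate N g -> List.In a (loc g) -> List.In b (loc g) ->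
  csum (loc g) (fun o => Cmul (Cconj (mat g o a)) (mat g o b)) = if a == b then C1 else C0.
Proof.
case: g => [q U|q1 q2 U] /=; last by case=> _ [_ [_ uU]] _ _; apply: uU.
by case=> _ uU [<-|[<-|[]]] [<-|[<-|[]]]; apply: uU.
Qed.

Lemma NoDup_loc g : List.NoDup (loc g).
Proof.
by case: g => [q U|q1 q2 U] /=; repeat constructor; rewrite /=; intuition discriminate.
Qed.

Lemma csum_delta {T : eqType} (s : list T) a (f : T -> cplx) : List.NoDup s -> List.In a s ->
  csum s (fun b => Cmul (if a == b then C1 else C0) (f b)) = f a.
Proof.
elim: s => [//|c s IH] nd; have [cs nds] := proj1 (List.NoDup_cons_iff _ _) nd.
rewrite csum_cons; case=> [ca|ins]; last first.
  have /negbTE -> : a != c by apply/eqP => ac; apply: cs; rewrite -ac.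
  by rewrite IH //; ring.
rewrite ca eqxx (@eq_csum _ _ _ (fun _ => C0)) ?csum0; first by ring.
move=> t ts; have /negbTE -> : a != t by apply/eqP => at_; apply: cs; rewrite ca at_.
by ring.
Qed.

(** The squared norm expands into a triple sum; summing over the output index first leaves the Gram
    matrix of the columns, which is the identity. *)
Lemma unitary_isometry {T : eqType} (s : list T) (U : T -> T -> cplx) (v : T -> cplx) :
  List.NoDup s ->
  (forall a b, List.In a s -> List.In b s ->
     csum s (fun o => Cmul (Cconj (U o a)) (U o b)) = if a == b then C1 else C0) ->
  lsum s (fun a => Cnorm2 (csum s (fun b => Cmul (U a b) (v b))))
  = lsum s (fun b => Cnorm2 (v b)).
Proof.
move=> nd uU.
suff: csum s (fun a => mkC (Cnorm2 (csum s (fun b => Cmul (U a b) (v b)))) 0)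
      = csum s (fun b => mkC (Cnorm2 (v b)) 0) by rewrite !csum_Cnorm2; case.
transitivity (csum s (fun b => csum s (fun c => csum s (fun a =>
    Cmul (Cmul (Cconj (U a b)) (U a c)) (Cmul (Cconj (v b)) (v c)))))).
  under [X in _ = X]eq_csum => b _ do rewrite csum_exchange.
  rewrite csum_exchange; apply: eq_csum => a _; rewrite Cnorm2E csum_conj csum_mulr.
  apply: eq_csum => b _; rewrite csum_mull; apply: eq_csum => c _.
  by rewrite Cconj_mul; ring.
apply: eq_csum => b bs; rewrite Cnorm2E -(@csum_delta _ s b (fun c => Cmul (Cconj (v b)) (v c))) //.
by apply: eq_csum => c cs; rewrite -uU // csum_mulr.
Qed.

(** Squared Euclidean norm of the first 2^N amplitudes; a state is a function on all of [nat]. *)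
Definition nrm2 (N : nat) (psi : state) : R := rsum (2 ^ N) (fun k => Cnorm2 (psi k)).

Lemma nrm2_ge0 N psi : 0 <= nrm2 N psi.
Proof. by apply: rsum_ge0 => k; apply: Cnorm2_ge0. Qed.

(** For fixed k, the indices [wr g k b] form a block on which the gate acts as a unitary matrix.
    Summing the block norms over all k counts each index [length (loc g)] times on both sides. *)
Lemma nrm2_apply_gate N g psi : wf_gate N g -> nrm2 N (apply_gate g psi) = nrm2 N psi.
Proof.
move=> wf; have l0 : INR (length (loc g)) <> 0 by case: (g) => *; rewrite /=; lra.
apply: (Rmult_eq_reg_l (INR (length (loc g)))) => //; rewrite /nrm2.
rewrite -2?(rsum_wr _ _ _ wf); apply: eq_rsum => k _.
rewrite -(unitary_isometry (loc g) (mat g) (fun b => psi (wr g k b))).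
- apply: eq_lsum => b bl; rewrite apply_gateE (rd_wr N) //.
  by congr Cnorm2; apply: eq_csum => c _; rewrite (wr_wr N).
- exact: NoDup_loc.
- by move=> *; apply: (wf_gate_unitary N).
Qed.

Lemma mat_le1 N g a b : wf_gate N g -> List.In a (loc g) -> List.In b (loc g) ->
  Cnorm2 (mat g a b) <= 1.
Proof.
move=> wf al bl; have := wf_gate_unitary _ _ _ _ wf bl bl; rewrite eqxx.
under eq_csum => o _ do rewrite -Cnorm2E.
rewrite csum_Cnorm2 => -[<-].
by apply: (lsum_ge _ (fun o => Cnorm2 (mat g o b))) => // t; apply: Cnorm2_ge0.
Qed.

(** * Commutation of gates on disjoint qubits *)

Definition disjoint_gates (g h : gate) : Prop :=
  forall q, List.In q (gate_qubits g) -> ~ List.In q (gate_qubits h).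

Lemma testbit_wr g k b q : ~ List.In q (gate_qubits g) ->
  Nat.testbit (wr g k b) q = Nat.testbit k q.
Proof.
case: g => [q1 U|q1 q2 U] /= nq; rewrite !testbit_setb.
  by case: Nat.eqb_spec => // e; case: nq; left.
case: Nat.eqb_spec => [e|_]; first by case: nq; right; left.
by case: Nat.eqb_spec => // e; case: nq; left.
Qed.

Lemma rd_disjoint g h k b : disjoint_gates g h -> rd g (wr h k b) = rd g k.
Proof.
move=> d; case: g d => [q1 U|q1 q2 U] d /=; rewrite !testbit_wr //; refine (d _ _) => /=; by [left|right; left].
Qed.

Lemma wr_setb g k b q c : ~ List.In q (gate_qubits g) ->
  wr g (setb k q c) b = setb (wr g k b) q c.
Proof.
case: g => [q1 U|q1 q2 U] /= nq; first by rewrite setb_comm // => e; apply: nq; left.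
rewrite (setb_comm k) ?(setb_comm _ q) // => e; apply: nq; rewrite -e; tauto.
Qed.

Lemma wr_comm g h k b c : disjoint_gates g h -> wr g (wr h k c) b = wr h (wr g k b) c.
Proof.
move=> d; have nq q : List.In q (gate_qubits h) -> ~ List.In q (gate_qubits g).
  by move=> qh qg; apply: d qg qh.
by case: h d nq => [q1 U|q1 q2 U] d nq /=; rewrite !wr_setb //; refine (nq _ _) => /=; by [left|right; left].
Qed.

Lemma apply_gate_comm g h psi : disjoint_gates g h ->
  apply_gate g (apply_gate h psi) = apply_gate h (apply_gate g psi).
Proof.
move=> d; have d' : disjoint_gates h g by move=> q qh qg; apply: d qg qh.
apply: functional_extensionality => k; rewrite !apply_gateE.
transitivity (csum (loc g) (fun b => csum (loc h) (fun c =>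
   Cmul (mat g (rd g k) b) (Cmul (mat h (rd h k) c) (psi (wr h (wr g k b) c)))))).
  apply: eq_csum => b _; rewrite apply_gateE csum_mull; apply: eq_csum => c _.
  by rewrite rd_disjoint.
rewrite csum_exchange; apply: eq_csum => c _; rewrite apply_gateE csum_mull.
by apply: eq_csum => b _; rewrite rd_disjoint // wr_comm //; ring.
Qed.

(** * Light cones *)

(** Locality of an observable in the Heisenberg picture, stated without operators: [f] cannot detect
    a gate applied outside S. *)
Definition supported (N : nat) (f : state -> R) (S : nat -> Prop) : Prop :=
  forall h psi, wf_gate N h -> (forall q, List.In q (gate_qubits h) -> ~ S q) ->
  f (apply_gate h psi) = f psi.

(** One step of the backward light cone. *)
Definition touched (L : layer) (S : nat -> Prop) (q : nat) : Prop :=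
  S q \/ exists g, List.In g L /\ List.In q (gate_qubits g) /\
         exists q', List.In q' (gate_qubits g) /\ S q'.

Lemma NoDup_app_disjoint {T : Type} (s r : list T) a :
  List.NoDup (List.app s r) -> List.In a s -> ~ List.In a r.
Proof.
elim: s => [//|b s IH] /= nd; have [bs /IH h] := proj1 (List.NoDup_cons_iff _ _) nd.
by case=> [<- ar|//]; apply: bs; apply/List.in_app_iff; right.
Qed.

Lemma wf_layer_cons N g L : wf_layer N (g :: L) ->
  [/\ wf_gate N g, wf_layer N L &
      forall h q, List.In h L -> List.In q (gate_qubits g) -> ~ List.In q (gate_qubits h)].
Proof.
case=> wf nd; split; first by apply: wf; left.
  by split => [h hL|]; [apply: wf; right|exact: List.NoDup_app_remove_l nd].
move=> h q hL qg qh; apply: (NoDup_app_disjoint _ _ _ nd qg).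
by apply/List.in_flat_map; exists h.
Qed.

(** Induction on the gates of the layer. A gate that meets S has all its qubits in the cone, so [h]
    commutes past it; a gate that misses S can be deleted. *)
Lemma supported_layer N L f S : wf_layer N L -> supported N f S ->
  supported N (fun psi => f (apply_layer L psi)) (touched L S).
Proof.
move=> wfL fS; elim: L wfL => [_|g L IH] /=.
  by move=> h psi wfh hS; apply: fS => // q qh Sq; apply: hS qh _; left.
move=> /wf_layer_cons [wfg /IH {}IH dis] h psi wfh hS.
have sub q : touched L S q -> touched (g :: L) S q.
  by move=> [Sq|[g' [g'L qg']]]; [left|right; exists g'; split => //; right].
rewrite /apply_layer /= -!/(apply_layer _ _).
case: (Classical_Prop.classic (exists q', List.In q' (gate_qubits g) /\ S q')) => [tg|ntg].
  rewrite apply_gate_comm; last first.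
    by move=> q qg qh; apply: (hS q qh); right; exists g; split; [left|split].
  by apply: IH => // q qh /sub; apply: hS.
(* [g] misses S and shares no qubit with the rest of the layer, so it lies outside the cone of [L]
   and the induction hypothesis removes it. *)
have free psi' : f (apply_layer L (apply_gate g psi')) = f (apply_layer L psi').
  apply: IH => // q qg [Sq|[g' [g'L [qg' _]]]]; first by apply: ntg; exists q.
  exact: dis g'L qg qg'.
by rewrite !free; apply: IH => // q qh /sub; apply: hS.
Qed.

Lemma length_gate_qubits g : (length (gate_qubits g) <= 2)%nat.
Proof. by case: g. Qed.

(** At most one gate of a layer acts on q, so [l] is the qubit list of that gate, or q alone. *)
Lemma layer_cover1 N L q : wf_layer N L ->
  exists l, [/\ (length l <= 2)%nat, List.In q l &
    forall g q', List.In g L -> List.In q (gate_qubits g) ->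
                 List.In q' (gate_qubits g) -> List.In q' l].
Proof.
elim: L => [_|g L IH]; first by exists [:: q]; split => //; left.
move=> /wf_layer_cons [_ /IH [l [l2 ql lP]] dis].
case: (List.In_dec Nat.eq_dec q (gate_qubits g)) => [qg|nqg]; last first.
  by exists l; split => // h q' [<-//|/lP]; apply.
exists (gate_qubits g); split => //; first exact: length_gate_qubits.
by move=> h q' [<-//|hL] qh; case: (dis h q).
Qed.

Lemma layer_cover N L S : wf_layer N L ->
  exists S', (length S' <= 2 * length S)%nat /\
    forall q, touched L (fun q' => List.In q' S) q -> List.In q S'.
Proof.
move=> wfL; elim: S => [|q0 S [S' [lS' IH]]].
  by exists [::]; split => // q [[]|[g [_ [_ [q' [_ []]]]]]].
have [l [l2 ql lP]] := layer_cover1 N L q0 wfL.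
exists (List.app l S'); split; first by rewrite List.length_app /=; lia.
move=> q; case=> [[<-|qS]|[g [gL [qg [q' [q'g [e|q'S]]]]]]]; apply/List.in_app_iff.
- by left.
- by right; apply: IH; left.
- by left; apply: (lP g q gL _ qg); rewrite e.
- by right; apply: IH; right; exists g; split => //; split => //; exists q'.
Qed.

(** S sits at the output. The induction hypothesis pulls it back through the later layers, then [L]
    is crossed; each layer at most doubles the set. *)
Lemma supported_run N Cc f S : wf_circuit N Cc -> supported N f (fun q => List.In q S) ->
  exists S', (length S' <= 2 ^ depth Cc * length S)%nat /\
    supported N (fun psi => f (run Cc psi)) (fun q => List.In q S').
Proof.
move=> wfC fS; elim: Cc wfC => [|L Cc IH] /= wfC; first by exists S; rewrite expn0 mul1n.
have [|S1 [lS1 S1P]] := IH; first by move=> L' L'C; apply: wfC; right.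
have wfL : wf_layer N L by apply: wfC; left.
have [S2 [lS2 S2P]] := layer_cover N L S1 wfL.
exists S2; split.
  rewrite /depth /= expnS -/(depth Cc).
  by move: lS1 lS2; set x := (2 ^ _)%nat; nia.
move=> h psi wfh hS; apply: (supported_layer _ _ _ _ wfL S1P) => // q qh t.
exact: hS qh (S2P _ t).
Qed.

(** * Measurement probabilities and bit flips *)

(** For a unit state, the squared norm of the result is the probability of measuring b on qubit
    i. *)
Definition project (i : nat) (b : bool) (psi : state) : state :=
  fun k => if Nat.testbit k i == b then psi k else C0.

(** A gate off qubit i commutes with the projection and preserves the norm. *)
Lemma supported_project N i b :
  supported N (fun psi => nrm2 N (project i b psi)) (fun q => List.In q [:: i]).
Proof.
move=> h psi wfh hi; rewrite -[RHS](nrm2_apply_gate N h) //; congr nrm2.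
apply: functional_extensionality => k; rewrite /project [RHS]apply_gateE.
have ih : ~ List.In i (gate_qubits h) by move=> /hi; apply; left.
under [RHS]eq_csum => c _ do rewrite testbit_wr //.
case: eqP => _; first exact: apply_gateE.
rewrite (@eq_csum _ _ _ (fun _ => C0)) ?csum0 // => t _; ring.
Qed.

(** The Pauli X gate, which turns the input 0 into the unit vector e_j. *)
Definition gate_not (j : nat) : gate := G1 j (fun a b => if a == b then C0 else C1).

Lemma wf_gate_not N j : (j < N)%nat -> wf_gate N (gate_not j).
Proof. by move=> jN; split => // -[] [] /=; apply: cplx_eq => /=; ring. Qed.

Lemma setbK k q : setb k q (Nat.testbit k q) = k.
Proof.
by apply: Nat.bits_inj => i; rewrite testbit_setb; case: Nat.eqb_spec => [->|].
Qed.

Lemma apply_gate_not j k : Nat.testbit k j = false ->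
  apply_gate (gate_not j) (basis k) = basis (setb k j true).
Proof.
move=> kj; apply: functional_extensionality => l; rewrite apply_gateE /= /basis.
case lj: (Nat.testbit l j).
  have -> : Nat.eqb l (setb k j true) = Nat.eqb (setb l j false) k.
    apply/idP/idP => /Nat.eqb_eq e; apply/Nat.eqb_eq.
      by rewrite e setb_setb -kj setbK.
    by rewrite -e setb_setb -lj setbK.
  by case: Nat.eqb => /=; ring.
have -> : Nat.eqb l (setb k j true) = false.
  by apply/Nat.eqb_neq => e; move: lj; rewrite e testbit_setb Nat.eqb_refl.
have -> : Nat.eqb (setb l j true) k = false.
  by apply/Nat.eqb_neq => e; move: kj; rewrite -e testbit_setb Nat.eqb_refl.
rewrite /=; ring.
Qed.

Lemma nrm2_basis N x : (x < 2 ^ N)%nat -> nrm2 N (basis x) = 1.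
Proof.
move=> xN; rewrite /nrm2 (rsum_single _ _ x) //.
  by rewrite /basis Nat.eqb_refl /Cnorm2 /=; lra.
by move=> k /Nat.eqb_neq; rewrite /basis => ->; rewrite /Cnorm2 /=; lra.
Qed.

Lemma nrm2_apply_layer N L psi : (forall g, List.In g L -> wf_gate N g) ->
  nrm2 N (apply_layer L psi) = nrm2 N psi.
Proof.
elim: L psi => [//|g L IH] psi wf; rewrite /apply_layer /= -/(apply_layer _ _).
by rewrite IH ?(nrm2_apply_gate N g) // => [|h hL]; apply: wf; [left|right].
Qed.

Lemma runE Cc psi : run Cc psi = apply_layer (List.concat Cc) psi.
Proof.
elim: Cc psi => [//|L Cc IH] psi.
by rewrite /run /= -/(run _ _) IH /apply_layer List.fold_left_app.
Qed.

Lemma wf_circuit_concat N Cc g : wf_circuit N Cc -> List.In g (List.concat Cc) -> wf_gate N g.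
Proof. by move=> wf /List.in_concat [L [/wf [wfL _]]] /wfL. Qed.

Lemma nrm2_run N Cc psi : wf_circuit N Cc -> nrm2 N (run Cc psi) = nrm2 N psi.
Proof. by move=> wf; rewrite runE nrm2_apply_layer // => g /wf_circuit_concat; apply. Qed.

(** * Binary expansions and the output of a CNOT circuit *)

Lemma bitsumS n (b : 'I_n.+1 -> bool) :
  (\sum_(i < n.+1) (if b i then 2 ^ i else 0) =
   2 * (\sum_(i < n) (if b (lift ord0 i) then 2 ^ i else 0)) + b ord0)%nat.
Proof.
rewrite big_ord_recl addnC big_distrr /=; congr (_ + _)%nat.
by apply: eq_bigr => i _; rewrite /bump /= add1n expnS; case: (b _); rewrite ?muln0.
Qed.

Lemma testbit_bitsum n (b : 'I_n -> bool) (i : 'I_n) :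
  Nat.testbit (\sum_(i < n) (if b i then 2 ^ i else 0))%nat i = b i.
Proof.
elim: n b i => [b []//|n IH] b i; rewrite bitsumS.
case: (unliftP ord0 i) => [j ->|->]; last by rewrite testbit_double0.
by rewrite lift0 testbit_doubleS IH.
Qed.

Lemma bitsum_lt n (b : 'I_n -> bool) :
  (\sum_(i < n) (if b i then 2 ^ i else 0) < 2 ^ n)%nat.
Proof.
elim: n b => [b|n IH b]; first by rewrite big_ord0.
rewrite bitsumS expnS; have := IH (fun i => b (lift ord0 i)).
by move: (_ ^ _)%nat => p; move: (\sum_(_ < _) _)%nat => s; case: (b ord0); lia.
Qed.

Lemma testbit_cnot_out n M x (i : 'I_n) :
  Nat.testbit (cnot_out n M x) i = (mulmx M (vec_of n x) i ord0 != GRing.zero).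
Proof. exact: (testbit_bitsum n (fun i => mulmx M (vec_of n x) i ord0 != GRing.zero)). Qed.

Lemma cnot_out_lt n M x : (cnot_out n M x < 2 ^ n)%nat.
Proof. exact: bitsum_lt. Qed.

Lemma cnot_out_row0 n (M : 'M['F_2]_n) (i : 'I_n) : Nat.testbit (cnot_out n M 0) i = false.
Proof.
rewrite testbit_cnot_out mxE big1 ?eqxx // => j _.
by rewrite mxE Nat.bits_0 GRing.mulr0.
Qed.

(** The input [setb 0 j true] encodes the unit vector e_j, so the output is column j of M. *)
Lemma cnot_out_col n (M : 'M['F_2]_n) (i j : 'I_n) :
  Nat.testbit (cnot_out n M (setb 0 j true)) i = (M i j != GRing.zero).
Proof.
rewrite testbit_cnot_out mxE (bigD1 j) // big1 => [|k kj].
  by rewrite [vec_of _ _ _ _]mxE testbit_setb Nat.eqb_refl GRing.mulr1 /= GRing.addr0.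
rewrite [vec_of _ _ _ _]mxE testbit_setb Nat.bits_0; case: Nat.eqb_spec => [e|_]; last by rewrite GRing.mulr0.
by move: kj; rewrite (val_inj e) eqxx.
Qed.

Lemma setb0_lt n (j : 'I_n) : (setb 0 j true < 2 ^ n)%nat.
Proof.
suff -> : setb 0 j true = (2 ^ j)%nat by rewrite ltn_exp2l.
rewrite /setb Nat.setbit_spec' Nat.lor_0_l; elim: (nat_of_ord j) => [//|q IH].
by rewrite expnS -IH Nat.pow_succ_r'.
Qed.

Lemma cnot_out_inj n (M M' : 'M['F_2]_n) :
  (forall x, (x < 2 ^ n)%nat -> cnot_out n M x = cnot_out n M' x) -> M = M'.
Proof.
move=> MM'; apply/matrixP => i j.
have xj := setb0_lt n j.
have := cnot_out_col n M i j; rewrite MM' // cnot_out_col.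
by case: (M i j) (M' i j) => [[|[|?]] ?] [[|[|?]] ?] //= _; apply: val_inj.
Qed.

(** * Distance to the ideal output, and row weights *)

Definition Ssub (psi phi : state) : state := fun k => Csub (psi k) (phi k).

Lemma Cnorm2_sub0 a : Cnorm2 (Csub a C0) = Cnorm2 a.
Proof. rewrite /Cnorm2 /=; ring. Qed.

(** Merges the two conditions of approximation into one distance on all n + m qubits: from index 2^n
    on, both the computed state and the ideal basis state vanish. *)
Lemma approximates_near n m Cc M eps x : 0 < eps -> approximates n m Cc M eps -> (x < 2 ^ n)%nat ->
  nrm2 (n + m) (Ssub (run Cc (basis x)) (basis (cnot_out n M x))) < eps ^ 2.
Proof.
move=> eps0 app xn; have [phi [_ [run_phi near]]] := app x xn.
have y_lt := cnot_out_lt n M x; set y := cnot_out n M x in near y_lt *.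
have le2 : (2 ^ n <= 2 ^ (n + m))%nat by rewrite leq_exp2l // leq_addr.
rewrite /nrm2 (rsum_split (2 ^ n)) // => [|k nk kN]; last first.
  rewrite /Ssub run_phi // ltnNge nk /= /basis.
  have /Nat.eqb_neq -> : k <> y by lia.
  by rewrite /Cnorm2 /=; ring.
rewrite (eq_rsum _ _ (fun j => Cnorm2 (Csub (phi j) (basis y j)))); last first.
  by move=> k kn; rewrite /Ssub run_phi ?kn //; apply: leq_trans le2.
set s := rsum _ _ in near *; have s0 : 0 <= s by apply: rsum_ge0 => k; apply: Cnorm2_ge0.
have := sqrt_sqrt s s0; have := sqrt_pos s; nra.
Qed.

Lemma nrm2_project N i psi :
  nrm2 N psi = nrm2 N (project i true psi) + nrm2 N (project i false psi).
Proof.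
rewrite -rsum_add; apply: eq_rsum => k _; rewrite /project /Cnorm2.
by case: Nat.testbit => /=; ring.
Qed.

(** The basis state y has no amplitude on outcome b, so subtracting it leaves the projected part
    unchanged. *)
Lemma nrm2_project_sub_basis N i b psi y : Nat.testbit y i = ~~ b ->
  nrm2 N (project i b psi) <= nrm2 N (Ssub psi (basis y)).
Proof.
move=> yi; apply: rsum_le => k _; rewrite /project /Ssub /basis.
case: eqP => [ki|_]; last first.
  have -> : Cnorm2 C0 = 0 by rewrite /Cnorm2 /=; ring.
  exact: Cnorm2_ge0.
have /Nat.eqb_neq -> : k <> y by move=> e; move: ki; rewrite e yi; case: b {yi}.
rewrite Cnorm2_sub0; lra.
Qed.

Lemma in_List (s : seq nat) x : List.In x s -> x \in s.
Proof. by elim: s => [//|a s IH] /= [->|/IH h]; rewrite inE ?eqxx // h orbT. Qed.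

(* Otherwise some input j with M i j <> 0 lies outside the backward light cone of output
   qubit i; flipping it flips bit i of the ideal output but leaves the probability of
   measuring 1 on qubit i unchanged, although it must be < 1/2 for one of the two
   inputs and > 1/2 for the other. *)
Lemma row_weight_le n m Cc M eps i : 0 < eps -> eps ^ 2 < 1 / 2 ->
  wf_circuit (n + m) Cc -> approximates n m Cc M eps ->
  (#|[set j | M i j != GRing.zero]| <= 2 ^ depth Cc)%nat.
Proof.
move=> eps0 eps2 wf app.
have [S [lS supS]] := supported_run (n + m) Cc _ [:: nat_of_ord i] wf (supported_project (n + m) i true).
rewrite /= muln1 in lS; apply: leq_trans lS.
rewrite cardE -(size_map val); apply: uniq_leq_size.
  by rewrite map_inj_uniq ?enum_uniq //; exact: val_inj.
move=> _ /mapP [j + ->]; rewrite mem_enum inE => Mij.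
apply/in_List; case: (List.In_dec Nat.eq_dec (val j) S) => // jS; exfalso.
have jN : (j < n + m)%nat by have := ltn_ord j; lia.
have := supS (gate_not j) (basis 0) (wf_gate_not _ _ jN).
rewrite apply_gate_not ?Nat.bits_0 // => flip.
have {}flip : nrm2 (n + m) (project i true (run Cc (basis (setb 0 j true)))) =
    nrm2 (n + m) (project i true (run Cc (basis 0))).
  by apply: flip => q [<-|[]].
have j_lt := setb0_lt n j.
have near0 := approximates_near _ _ _ _ _ _ eps0 app (expn_gt0 2 n).
have nearj := approximates_near _ _ _ _ _ _ eps0 app j_lt.
have p0 := nrm2_project_sub_basis (n + m) i true (run Cc (basis 0)) _ (cnot_out_row0 n M i).
have := nrm2_project_sub_basis (n + m) i false (run Cc (basis (setb 0 j true))) _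
  (etrans (cnot_out_col n M i j) Mij).
(* Outcome 1 on input 0 and outcome 0 on input e_j both have probability below eps^2. Since outcome
   1 is equally likely on both inputs, the total probability 1 would be below 2 eps^2 < 1. *)
have := nrm2_project (n + m) i (run Cc (basis (setb 0 j true))).
rewrite nrm2_run // nrm2_basis; first lra.
by apply: leq_trans j_lt _; rewrite leq_exp2l // leq_addr.
Qed.

(** * Rounding circuits *)

(* Pointwise |x + y|^2 <= (1 + b/a) |x|^2 + (1 + a/b) |y|^2. *)
Lemma nrm2_triangle N psi phi chi a b : 0 < a -> 0 < b ->
  nrm2 N (Ssub psi phi) <= a ^ 2 -> nrm2 N (Ssub phi chi) <= b ^ 2 ->
  nrm2 N (Ssub psi chi) <= (a + b) ^ 2.
Proof.
move=> a0 b0 ha hb.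
apply: (Rle_trans _ ((1 + b / a) * nrm2 N (Ssub psi phi) + (1 + a / b) * nrm2 N (Ssub phi chi))).
  rewrite /nrm2 -!rsum_mull -rsum_add; apply: rsum_le => k _; rewrite /Ssub.
  have real_ineq x y : (x + y) ^ 2 <= (1 + b / a) * x ^ 2 + (1 + a / b) * y ^ 2.
    have -> : (1 + b / a) * x ^ 2 + (1 + a / b) * y ^ 2 = (x + y) ^ 2 + (b * x - a * y) ^ 2 * / (a * b).
      by field; lra.
    have := pow2_ge_0 (b * x - a * y); have : 0 < / (a * b) by apply: Rinv_0_lt_compat; nra.
    nra.
  have := real_ineq (cre (psi k) - cre (phi k)) (cre (phi k) - cre (chi k)).
  have := real_ineq (cim (psi k) - cim (phi k)) (cim (phi k) - cim (chi k)).
  by rewrite /Cnorm2 /=; lra.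
have -> : (a + b) ^ 2 = (1 + b / a) * a ^ 2 + (1 + a / b) * b ^ 2 by field; lra.
have pos x y : 0 < x -> 0 < y -> 0 <= 1 + x / y.
  by move=> x0 y0; have := Rdiv_lt_0_compat _ _ x0 y0; lra.
by apply: Rplus_le_compat; apply: Rmult_le_compat_l => //; apply: pos.
Qed.

Lemma nrm2_subC N psi phi : nrm2 N (Ssub psi phi) = nrm2 N (Ssub phi psi).
Proof. by apply: eq_rsum => k _; rewrite /Ssub /Cnorm2 /=; ring. Qed.

Lemma nrm2_sub_basis N x y : (x < 2 ^ N)%nat -> (y < 2 ^ N)%nat -> x <> y ->
  nrm2 N (Ssub (basis x) (basis y)) = 2.
Proof.
move=> xN yN xy; rewrite -[RHS]/(1 + 1) -{1}(nrm2_basis N x) // -(nrm2_basis N y) // -rsum_add.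
apply: eq_rsum => k _; rewrite /Ssub /basis.
case: Nat.eqb_spec => [->|_]; last by rewrite /Cnorm2; case: Nat.eqb => /=; ring.
by have /Nat.eqb_neq -> := xy; rewrite /Cnorm2 /=; ring.
Qed.

Lemma apply_gate_sub g psi phi :
  apply_gate g (Ssub psi phi) = Ssub (apply_gate g psi) (apply_gate g phi).
Proof.
apply: functional_extensionality => k; rewrite /Ssub !apply_gateE.
transitivity (csum (loc g) (fun b => Cadd (Cmul (mat g (rd g k) b) (psi (wr g k b)))
    (Cmul (Copp C1) (Cmul (mat g (rd g k) b) (phi (wr g k b)))))).
  by apply: eq_csum => b _; ring.
rewrite csum_add -csum_mull; ring.
Qed.

(** The discrete data of a gate; the last component is a dummy 0 for a single-qubit gate. *)
Definition shape (g : gate) : bool * nat * nat :=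
  match g with G1 q _ => (false, q, O) | G2 q1 q2 _ => (true, q1, q2) end.

Definition close (d : R) (g h : gate) : Prop :=
  shape g = shape h /\
  forall a b, List.In a (loc g) -> List.In b (loc g) ->
    Rabs (cre (mat g a b) - cre (mat h a b)) <= d /\
    Rabs (cim (mat g a b) - cim (mat h a b)) <= d.

Lemma shape_eq g h : shape g = shape h -> [/\ loc g = loc h, rd g = rd h & wr g = wr h].
Proof. by case: g h => [q U|q1 q2 U] [q' V|q1' q2' V] //= [] *; subst. Qed.

(** Entries differ by at most 2 d^2 in squared modulus, Cauchy-Schwarz over at most 4 configurations
    gives 8 d^2, and [rsum_wr] contributes another factor of at most 4. The total 32 d^2 is rounded
    up to the square (6 d)^2. *)
Lemma nrm2_close_gate N d g h psi : wf_gate N g -> close d g h ->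
  nrm2 N (Ssub (apply_gate g psi) (apply_gate h psi)) <= (6 * d) ^ 2 * nrm2 N psi.
Proof.
move=> wf [/shape_eq [eloc erd ewr] near].
have l0 : 0 <= INR (length (loc g)) <= 4.
  by split; [exact: pos_INR|case: (g) => *; rewrite /=; lra].
apply: (Rle_trans _ (rsum (2 ^ N) (fun k =>
    lsum (loc g) (fun b => 8 * d ^ 2 * Cnorm2 (psi (wr g k b)))))); last first.
  rewrite (rsum_wr _ _ (fun k => 8 * d ^ 2 * Cnorm2 (psi k))) // rsum_mull -/(nrm2 N psi).
  have := Rmult_le_pos _ _ (pow2_ge_0 d) (nrm2_ge0 N psi); set t := d ^ 2 * _ => t0.
  have -> : (6 * d) ^ 2 * nrm2 N psi = 36 * t by rewrite /t; ring.
  by have -> : 8 * d ^ 2 * nrm2 N psi = 8 * t by [rewrite /t; ring]; nra.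
apply: rsum_le => k _; rewrite /Ssub !apply_gateE -eloc -erd -ewr.
have -> : Csub (csum (loc g) (fun b => Cmul (mat g (rd g k) b) (psi (wr g k b))))
               (csum (loc g) (fun b => Cmul (mat h (rd g k) b) (psi (wr g k b))))
   = csum (loc g) (fun b => Cmul (Csub (mat g (rd g k) b) (mat h (rd g k) b)) (psi (wr g k b))).
  transitivity (Cadd (csum (loc g) (fun b => Cmul (mat g (rd g k) b) (psi (wr g k b))))
    (Cmul (Copp C1) (csum (loc g) (fun b => Cmul (mat h (rd g k) b) (psi (wr g k b)))))).
    by ring.
  by rewrite csum_mull -csum_add; apply: eq_csum => b _; ring.
apply: Rle_trans (Cnorm2_csum_le _ _) _.
rewrite -(lsum_mull _ _ (INR _)); apply: lsum_le => b bl.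
have [] := near _ _ (rd_loc g k) bl; rewrite Cnorm2_mul.
move: (Cnorm2_ge0 (psi (wr g k b))) => p0 hr hi.
have sq x : Rabs x <= d -> x * x <= d ^ 2.
  by rewrite /Rabs; case: Rcase_abs; nra.
have c2 : Cnorm2 (Csub (mat g (rd g k) b) (mat h (rd g k) b)) <= 2 * d ^ 2.
  by rewrite /Cnorm2 /=; have := sq _ hr; have := sq _ hi; lra.
have := Cnorm2_ge0 (Csub (mat g (rd g k) b) (mat h (rd g k) b)).
set x := Cnorm2 (Csub _ _) in c2 * => x0.
have -> : 8 * d ^ 2 * Cnorm2 (psi (wr g k b)) = 4 * (2 * d ^ 2 * Cnorm2 (psi (wr g k b))) by ring.
apply: Rmult_le_compat; [lra|nra|lra|nra].
Qed.

(** Hybrid argument: replacing one gate adds at most 6 d to the distance, and the gates after it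
    preserve distances. *)
Lemma nrm2_close_layer N d s gs hs psi phi : 0 < d -> 0 < s ->
  (forall g, List.In g gs -> wf_gate N g) -> (forall h, List.In h hs -> wf_gate N h) ->
  List.Forall2 (close d) gs hs -> nrm2 N psi = 1 ->
  nrm2 N (Ssub psi phi) <= s ^ 2 ->
  nrm2 N (Ssub (apply_layer gs psi) (apply_layer hs phi)) <= (s + INR (length gs) * (6 * d)) ^ 2.
Proof.
move=> d0 s0 wfg wfh c; elim: c s psi phi s0 wfg wfh => [|g h {}gs {}hs gh _ IH] s psi phi s0 wfg wfh psi1 near.
  by rewrite /= Rmult_0_l Rplus_0_r.
rewrite [length _]/= S_INR /apply_layer /= -!/(apply_layer _ _).
have -> : s + (INR (length gs) + 1) * (6 * d) = (6 * d + s) + INR (length gs) * (6 * d) by ring.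
have wg : wf_gate N g by apply: wfg; left.
have wh : wf_gate N h by apply: wfh; left.
apply: IH; [lra|by move=> *; apply: wfg; right|by move=> *; apply: wfh; right| |].
  by rewrite nrm2_apply_gate.
apply: (nrm2_triangle _ _ (apply_gate h psi)) => //; first lra.
  by have := nrm2_close_gate N d g h psi wg gh; rewrite psi1; lra.
by rewrite -apply_gate_sub nrm2_apply_gate.
Qed.

(** If the ideal outputs differed at some x, they would be at distance sqrt 2. The path between them
    through the two computed states is shorter: eps at each end, and the rounding error in the
    middle. *)
Lemma approximates_unique n m Cc Cc' M M' eps d : 0 < eps -> 0 < d ->
  wf_circuit (n + m) Cc -> wf_circuit (n + m) Cc' ->
  approximates n m Cc M eps -> approximates n m Cc' M' eps ->
  List.Forall2 (close d) (List.concat Cc) (List.concat Cc') ->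
  2 * eps + (INR (length (List.concat Cc)) + 1) * (6 * d) < sqrt 2 -> M = M'.
Proof.
move=> eps0 d0 wf wf' app app' near small; apply: cnot_out_inj => x xn.
case: (Nat.eq_dec (cnot_out n M x) (cnot_out n M' x)) => // ne; exfalso.
have le2 : (2 ^ n <= 2 ^ (n + m))%nat by rewrite leq_exp2l // leq_addr.
set N := (n + m)%nat in wf wf' le2 *.
have xN := leq_trans xn le2.
have e1 := Rlt_le _ _ (approximates_near _ _ _ _ _ _ eps0 app xn).
have e2 := Rlt_le _ _ (approximates_near _ _ _ _ _ _ eps0 app' xn).
(* Both runs start from the same state, but [nrm2_close_layer] wants a positive initial error;
   taking 6 d for it produces the [+ 1] in the bound. *)
have close_runs : nrm2 N (Ssub (run Cc (basis x)) (run Cc' (basis x)))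
    <= (6 * d + INR (length (List.concat Cc)) * (6 * d)) ^ 2.
  rewrite !runE; apply: nrm2_close_layer => //; first lra.
  - by move=> g; apply: wf_circuit_concat.
  - by move=> g; apply: wf_circuit_concat.
  - exact: nrm2_basis.
  - rewrite /nrm2 rsum0 => [|k _]; first nra.
    by rewrite /Ssub /Cnorm2 /=; ring.
rewrite nrm2_subC in e1.
have D0 : 0 < 6 * d + INR (length (List.concat Cc)) * (6 * d).
  by have := pos_INR (length (List.concat Cc)); nra.
have := nrm2_triangle _ _ _ _ _ _ eps0 D0 e1 close_runs => e3.
have := nrm2_triangle _ _ _ _ _ _ _ eps0 e3 e2.
rewrite nrm2_sub_basis //; try by apply: leq_trans (cnot_out_lt _ _ _) le2.
move=> /(_ ltac:(lra)) two_le.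
have := sqrt_sqrt 2; have := sqrt_pos 2; nra.
Qed.

(** * Finite codes for rounded circuits *)

(** [up] is the floor plus one, so for r in [-1, 1] the value is at most 2K + 1 and fits the
    type. *)
Definition round_code (K : nat) (r : R) : 'I_(2 * K).+2 :=
  inord (Z.to_nat (up ((r + 1) * INR K))).

Lemma round_code_close K r r' : (0 < K)%nat -> -1 <= r <= 1 -> -1 <= r' <= 1 ->
  round_code K r = round_code K r' -> Rabs (r - r') <= / INR K.
Proof.
move=> K0 hr hr'; have k0 : 0 < INR K by apply: lt_0_INR; lia.
have up_bounds s : -1 <= s <= 1 -> 
    Z.le 0 (up ((s + 1) * INR K)) /\ Z.le (up ((s + 1) * INR K)) (Z.of_nat (2 * K + 1)).
  move=> hs; have [up1 up2] := archimed ((s + 1) * INR K).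
  split; first by apply: le_IZR; nra.
  by apply: le_IZR; rewrite -INR_IZR_INZ plus_INR mult_INR /=; nra.
move=> /(congr1 val); have := up_bounds _ hr; have := up_bounds _ hr'.
rewrite /round_code; set z := up _; set z' := up _ => b' b.
rewrite /= !inordK; [|lia|lia] => e; have {b b'}e : z' = z by lia.
have [] := archimed ((r + 1) * INR K); have [] := archimed ((r' + 1) * INR K).
rewrite -/z -/z' e => a1 a2 a3 a4.
apply: (Rmult_le_reg_r (INR K)) => //; rewrite Rinv_l; last lra.
rewrite -{1}(Rabs_pos_eq (INR K)); last lra.
by rewrite -Rabs_mult; apply: Rabs_le; lra.
Qed.

(** A shape and a table of 16 matrix entries with real and imaginary parts, hence the exponent 32 in
    the cardinality. *)
Definition gate_code_type (N K : nat) : finType :=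
  (bool * 'I_N.+1 * 'I_N.+1 *
   {ffun (bool * bool) * (bool * bool) * bool -> 'I_(2 * K).+2})%type.

Definition gate_code (N K : nat) (g : gate) : gate_code_type N K :=
  let: (t, q1, q2) := shape g in
  (t, inord q1, inord q2,
   [ffun p => round_code K ((if p.2 then cim else cre) (mat g p.1.1 p.1.2))]).

Lemma Cnorm2_le1 a : Cnorm2 a <= 1 -> -1 <= cre a <= 1 /\ -1 <= cim a <= 1.
Proof. by rewrite /Cnorm2; set x := cre a; set y := cim a => h; split; nra. Qed.

Lemma shape_lt N g : wf_gate N g -> ((shape g).1.2 < N.+1)%nat /\ ((shape g).2 < N.+1)%nat.
Proof. by case: g => [q U|q1 q2 U] /= => [[? _]|[? [? _]]]; lia. Qed.

Lemma gate_code_close N K g h : (0 < K)%nat -> wf_gate N g -> wf_gate N h ->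
  gate_code N K g = gate_code N K h -> close (/ INR K) g h.
Proof.
move=> K0 wg wh; have [] := shape_lt _ _ wg; have [] := shape_lt _ _ wh.
rewrite /gate_code; case eg: (shape g) => [[t q1] q2]; case eh: (shape h) => [[t' q1'] q2'] /=.
move=> q1'N q2'N q1N q2N e.
have et : t = t' := congr1 (fun c => c.1.1.1) e.
have /= := congr1 (fun c => val c.1.1.2) e; have /= := congr1 (fun c => val c.1.2) e.
rewrite !inordK // => e2 e1.
have ent := congr1 (fun c => c.2) e; move/ffunP: ent => /= ent.
have egh : shape g = shape h by rewrite eg eh et e1 e2.
split => // a b al bl.
have [eloc _ _] := shape_eq _ _ egh.
have [] := Cnorm2_le1 _ (mat_le1 _ _ _ _ wg al bl).
rewrite eloc in al bl; have [] := Cnorm2_le1 _ (mat_le1 _ _ _ _ wh al bl).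
move: (ent ((a, b), false)) (ent ((a, b), true)); rewrite !ffunE /= => er ei.
by split; apply: round_code_close.
Qed.

Lemma card_gate_code_type N K :
  #|gate_code_type N K| = (2 * N.+1 * N.+1 * (2 * K).+2 ^ 32)%nat.
Proof. by rewrite !card_prod card_ffun !card_prod !card_ord card_bool. Qed.

(** Slots past the end of the gate list hold [None], so the code also determines the number of gates
    when it is at most L. *)
Definition circuit_code (N K L : nat) (gs : list gate) : {ffun 'I_L -> option (gate_code_type N K)} :=
  [ffun i : 'I_L => onth (map (gate_code N K) gs) i].

Lemma circuit_code_close N K L gs hs : (0 < K)%nat ->
  (forall g, List.In g gs -> wf_gate N g) -> (forall h, List.In h hs -> wf_gate N h) ->
  (length gs <= L)%nat -> (length hs <= L)%nat ->
  circuit_code N K L gs = circuit_code N K L hs -> List.Forall2 (close (/ INR K)) gs hs.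
Proof.
move=> K0 wfg wfh lg lh /ffunP e.
have {}e : map (gate_code N K) gs = map (gate_code N K) hs.
  apply: eq_from_onth_le => i; rewrite !size_map => iL.
  have iL' : (i < L)%nat by apply: leq_trans iL _; rewrite geq_max lg.
  by have := e (Ordinal iL'); rewrite !ffunE.
elim: gs hs wfg wfh e {lg lh} => [|g gs IH] [|h hs] // wfg wfh [eg es]; constructor.
  by apply: (gate_code_close N) => //; [apply: wfg; left|apply: wfh; left].
by apply: IH => // [g' ?|h' ?]; [apply: wfg; right|apply: wfh; right].
Qed.

(** Choose one circuit for each matrix of A; by [approximates_unique] the code of that circuit
    determines the matrix. *)
Lemma card_approximable n m eps L K (A : {set 'M['F_2]_n}) : 0 < eps -> (0 < K)%nat ->
  2 * eps + (INR L + 1) * (6 * / INR K) < sqrt 2 ->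
  (forall M, M \in A -> exists Cc, [/\ wf_circuit (n + m) Cc, approximates n m Cc M eps
                                    & (length (List.concat Cc) <= L)%nat]) ->
  (#|A| <= (2 * (n + m).+1 * (n + m).+1 * (2 * K).+2 ^ 32).+1 ^ L)%nat.
Proof.
move=> eps0 K0 small ex.
pose P M Cc := [/\ wf_circuit (n + m) Cc, approximates n m Cc M eps
                 & (length (List.concat Cc) <= L)%nat].
pose C M := epsilon (inhabits nil) (P M).
have CP M : M \in A -> P M (C M) by move=> /ex MA; apply: epsilon_spec.
pose F M := circuit_code (n + m) K L (List.concat (C M)).
have Finj : {in A &, injective F}.
  move=> M M' /CP [wf app len] /CP [wf' app' len'] eF.
  have d0 : 0 < / INR K by apply: Rinv_0_lt_compat; apply: lt_0_INR; lia.
  apply: (approximates_unique n m (C M) (C M') M M' eps (/ INR K)) => //.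
    by apply: (circuit_code_close _ _ _ _ _ K0 _ _ len len' eF) => g; apply: wf_circuit_concat.
  have : INR (length (List.concat (C M))) <= INR L by apply: le_INR; lia.
  by move: small; nra.
rewrite -(card_in_imset Finj); apply: leq_trans (max_card _) _.
by rewrite card_ffun card_option card_gate_code_type card_ord.
Qed.

(** * Counting gates and matrices *)

Lemma uniq_bounded_length N (s : list nat) : List.NoDup s ->
  (forall x, List.In x s -> (x < N)%nat) -> (length s <= N)%nat.
Proof.
move=> nd lt; rewrite -[N](List.length_seq N O).
by apply/leP; apply: List.NoDup_incl_length => // x /lt xN; apply/List.in_seq; lia.
Qed.

(** Every gate occupies at least one qubit, and no qubit is used twice. *)
Lemma length_layer N L : wf_layer N L -> (length L <= N)%nat.
Proof.
case=> wf nd; apply: (@leq_trans (length (List.flat_map gate_qubits L))); last first.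
  apply: uniq_bounded_length => // q /List.in_flat_map [g [/wf]].
  by case: g => [q1 U|q1 q2 U] /=; [case=> ? _ [<-|[]]|case=> ? [? _] [<-|[<-|[]]]].
elim: L {wf nd} => [//|g L IH]; rewrite /= List.length_app.
by move: IH; case: g => * /=; lia.
Qed.

Lemma length_circuit N Cc : wf_circuit N Cc -> (length (List.concat Cc) <= depth Cc * N)%nat.
Proof.
elim: Cc => [//|L Cc IH] wf; rewrite /depth /= List.length_app mulSn.
apply: leq_add; first by apply: length_layer; apply: wf; left.
by apply: IH => L' L'C; apply: wf; right.
Qed.

(** A vector over F_2 is the indicator of its support, and a support of size at most w can be listed
    in w slots, each holding an index or [None]. *)
Lemma card_low_weight_ffun n w :
  (#|[set v : {ffun 'I_n -> 'F_2} | #|[set j | v j != GRing.zero]| <= w]| <= n.+1 ^ w)%nat.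
Proof.
pose F (f : {ffun 'I_w -> option 'I_n}) : {ffun 'I_n -> 'F_2} :=
  [ffun j => if Some j \in codom f then GRing.one 'F_2 else @GRing.zero 'F_2].
have -> : (n.+1 ^ w)%nat = #|{ffun 'I_w -> option 'I_n}|.
  by rewrite card_ffun card_option !card_ord.
rewrite -cardsT; apply: leq_trans (leq_imset_card F _); apply: subset_leq_card.
apply/subsetP => v; rewrite inE => vw; apply/imsetP.
pose s := enum [set j | v j != GRing.zero].
exists [ffun i : 'I_w => onth s i] => //; apply/ffunP => j; rewrite ffunE.
have -> : (Some j \in codom [ffun i : 'I_w => onth s i]) = (j \in s).
  apply/codomP/onthP => [[i]|[i ij]]; first by rewrite ffunE => e; exists i.
  have iw : (i < w)%nat by apply: leq_trans vw; rewrite cardE -onthTE ij.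
  by exists (Ordinal iw); rewrite ffunE.
rewrite mem_enum inE.
by case: (v j) => [[|[|?]] ?] //=; apply: val_inj.
Qed.

Lemma card_low_weight_matrices n w :
  (#|[set M : 'M['F_2]_n | [forall i, #|[set j | M i j != GRing.zero]| <= w]]| <= (n.+1 ^ w) ^ n)%nat.
Proof.
set A := [set M | _].
pose B := [set v : {ffun 'I_n -> 'F_2} | (#|[set j | v j != GRing.zero]| <= w)%nat].
pose F (M : 'M['F_2]_n) := [ffun i => [ffun j => M i j]].
have Finj : injective F.
  by move=> M M' /ffunP e; apply/matrixP => i j; have /ffunP/(_ j) := e i; rewrite !ffunE.
rewrite -(card_imset A Finj).
apply: (@leq_trans #|[set f : {ffun 'I_n -> {ffun 'I_n -> 'F_2}} | f \in ffun_on (mem B)]|).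
  apply: subset_leq_card; apply/subsetP => _ /imsetP [M MA ->].
  rewrite inE; apply/ffun_onP => i; rewrite ffunE inE.
  move: MA; rewrite inE => /forallP /(_ i).
  by congr (#|pred_of_set _| <= w)%nat; apply/setP => j; rewrite !inE ffunE.
have mono a b : (a <= b)%nat -> (a ^ n <= b ^ n)%nat by case: (n) => // k; rewrite leq_exp2r.
by rewrite cardsE card_ffun_on card_ord; apply: mono; apply: card_low_weight_ffun.
Qed.

(** In the order formula 2^C(n,2) * prod_(1 <= i <= n) (2^i - 1), each factor 2^i - 1 is at least
    2^(i-1). These contribute a second 2^C(n,2). *)
Lemma card_unitmx_ge n : (0 < n)%nat ->
  (2 ^ (n * (n - 1)) <= #|[set M : 'M['F_2]_n | M \in unitmx]|)%nat.
Proof.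
case: n => // n _.
have -> : #|[set M : 'M['F_2]_n.+1 | M \in unitmx]| = #|'GL_n.+1['F_2]%g|.
  rewrite cardsT card_sub; apply: eq_card => M; by rewrite !inE.
rewrite card_GL // card_Fp //.
apply: (@leq_trans (2 ^ 'C(n.+1, 2) * \prod_(1 <= i < n.+2) 2 ^ i.-1)); last first.
  rewrite leq_mul2l; apply/orP; right; rewrite big_nat_cond [X in (_ <= X)%nat]big_nat_cond.
  elim/big_ind2: _ => // [x1 x2 y1 y2|[|i] _ //]; first exact: leq_mul.
  by rewrite /= expnS; have := expn_gt0 2 i; move: (2 ^ i)%nat => p /=; lia.
rewrite -expn_sum -expnD leq_exp2l //.
rewrite big_add1 bin2_sum addnn bin2 even_halfK ?subn1 //.
by rewrite oddM /= andNb.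
Qed.

(** * Asymptotics *)

Lemma INR_leq a b : (a <= b)%nat -> INR a <= INR b.
Proof. by move=> ab; apply: le_INR; lia. Qed.

Lemma leq_INR a b : INR a <= INR b -> (a <= b)%nat.
Proof. by move=> /INR_le; lia. Qed.

Lemma INR_expn a b : INR (a ^ b)%nat = INR a ^ b.
Proof. by elim: b => [//|b IH]; rewrite expnS mult_INR IH. Qed.

Lemma ln2_gt0 : 0 < ln 2.
Proof. by rewrite -ln_1; apply: ln_increasing; lra. Qed.

Lemma expn_le_ln a b p q : (0 < a)%nat -> (0 < b)%nat ->
  INR p * ln (INR a) <= INR q * ln (INR b) -> (a ^ p <= b ^ q)%nat.
Proof.
move=> a0 b0 le; have a0' : 0 < INR a by apply: lt_0_INR; lia.
have b0' : 0 < INR b by apply: lt_0_INR; lia.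
apply: leq_INR; rewrite !INR_expn; apply: Rnot_lt_le => lt.
have := ln_increasing _ _ (pow_lt _ q b0') lt.
by rewrite !ln_pow //; lra.
Qed.

Lemma exists_floor x : 0 <= x -> exists L : nat, INR L <= x /\ forall k : nat, INR k <= x -> (k <= L)%nat.
Proof.
move=> x0; have [up1 up2] := archimed x; have up0 : (Z.lt 0 (up x)) by apply: lt_IZR; lra.
exists (Z.to_nat (Z.sub (up x) 1)).
have e : INR (Z.to_nat (Z.sub (up x) 1)) = IZR (up x) - 1.
  by rewrite INR_IZR_INZ Z2Nat.id ?minus_IZR //; lia.
split=> [|k kx]; first by rewrite e; lra.
suff : INR k < INR (Z.to_nat (Z.sub (up x) 1)).+1 by move=> /INR_lt; lia.
by rewrite S_INR e; lra.
Qed.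

(** The integer fourth root of n serves as the threshold for row weights. *)
Lemma exists_root4 n : exists t, (t ^ 4 <= n)%nat /\ (n < t.+1 ^ 4)%nat.
Proof.
elim: n => [|n [t [tn nt]]]; first by exists 0%nat.
case: (ltnP n.+1 (t.+1 ^ 4)) => h; first by exists t; split => //; lia.
exists t.+1; split => //; apply: (leq_ltn_trans nt).
by rewrite ltn_exp2r.
Qed.

(** Here n + 1 <= (t+1)^4 <= 2^(4t), so the left side is at most 2^(8 t^2 n); for t >= 4, 16 t^2 <=
    t^4 <= n. Squaring the count avoids the exponent n^2 / 2. *)
Lemma low_weight_count_sq n t : (256 <= n)%nat -> (t ^ 4 <= n)%nat -> (n < t.+1 ^ 4)%nat ->
  (((n.+1 ^ t) ^ n) ^ 2 <= 2 ^ (n * n))%nat.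
Proof.
move=> n256 tn nt; have t4 : (4 <= t)%nat.
  rewrite leqNgt; apply/negP => t3; have : (n < 4 ^ 4)%nat.
    by apply: leq_trans nt _; rewrite leq_exp2r.
  by rewrite (_ : 4 ^ 4 = 256)%nat // ltnNge n256.
have n1 : (n.+1 <= 2 ^ (t * 4))%nat.
  by apply: leq_trans nt _; rewrite expnM leq_exp2r // ltn_expl.
have n0 : (0 < n)%nat by lia.
have n1' : ((n.+1 ^ t) ^ n <= ((2 ^ (t * 4)) ^ t) ^ n)%nat.
  by rewrite !leq_exp2r //; lia.
apply: (@leq_trans ((((2 ^ (t * 4)) ^ t) ^ n) ^ 2)); first by rewrite leq_exp2r.
rewrite -!expnM leq_exp2l //.
have : (16 * (t * t) <= n)%nat.
  by apply: leq_trans tn; rewrite !expnS expn0 muln1; nia.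
by nia.
Qed.

(** With precision K = K0 n^2, N + 1 <= N^2 and 2K + 2 <= N^3, so there are at most 2 N^100 codes;
    the outer successor accounts for [None]. *)
Lemma gate_code_count_le N K0 n : (n <= N)%nat -> (2 * K0 + 4 <= N)%nat ->
  ((2 * N.+1 * N.+1 * (2 * (K0 * (n * n))).+2 ^ 32).+1 <= N ^ 102)%nat.
Proof.
move=> nN KN; have N0 : (0 < N)%nat by lia.
have e1 : (N.+1 <= N ^ 2)%nat by rewrite expnS expn1; nia.
have e2 : ((2 * (K0 * (n * n))).+2 <= N ^ 3)%nat.
  rewrite !expnS expn0 muln1.
  have : (n * n <= N * N)%nat by rewrite leq_mul.
  by move: (n * n)%nat (N * N)%nat (muln_gt0 N N) => a b; rewrite N0 /= => b0; nia.
have le : (2 * N.+1 * N.+1 * (2 * (K0 * (n * n))).+2 ^ 32 <= 2 * N ^ 2 * N ^ 2 * (N ^ 3) ^ 32)%nat.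
  by rewrite !leq_mul // leq_exp2r.
apply: leq_ltn_trans le _.
have -> : (N ^ 102 = N ^ 2 * N ^ 100)%nat by rewrite -expnD.
have -> : (2 * N ^ 2 * N ^ 2 * (N ^ 3) ^ 32 = 2 * N ^ 100)%nat.
  by rewrite -expnM -(mulnA 2%nat (N ^ 2)%nat) -(mulnA 2%nat) -!expnD.
by rewrite ltn_pmul2r ?expn_gt0 ?N0 // expnS expn1; nia.
Qed.

Lemma log2_ge1 N : (2 <= N)%nat -> 1 <= log2 (INR N).
Proof.
move=> N2; have := ln2_gt0 => l2; rewrite /log2.
apply: (Rmult_le_reg_r (ln 2)) => //; rewrite /Rdiv Rmult_assoc Rinv_l; last lra.
have : INR 2 <= INR N by apply: INR_leq.
rewrite /= => le; case: (Rle_lt_or_eq_dec 2 (INR N)) => [|lt|<-]; [lra| |lra].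
by have := ln_increasing 2 (INR N) ltac:(lra) lt; lra.
Qed.

(** Otherwise n < (t+1)^4 <= 2^(4d) <= n, the last step because 4 d <= log2 n. *)
Lemma small_depth_lightcone n d t : (0 < n)%nat -> INR d < 1 / 204 * log2 (INR n) ->
  (n < t.+1 ^ 4)%nat -> (2 ^ d <= t)%nat.
Proof.
move=> n0 dn nt; rewrite leqNgt; apply/negP => td.
have : (t.+1 ^ 4 <= n)%nat; last by lia.
apply: (@leq_trans ((2 ^ d) ^ 4)); first by rewrite leq_exp2r.
rewrite -expnM -[X in (_ <= X)%nat]expn1; apply: expn_le_ln => //.
have l2 := ln2_gt0; have n1 : 1 <= INR n by apply: (INR_leq 1).
have ln0 : 0 <= ln (INR n).
  by rewrite -ln_1; case: n1 => [lt|<-]; [apply: Rlt_le; apply: ln_increasing; lra|lra].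
have e : log2 (INR n) * ln 2 = ln (INR n) by rewrite /log2; field; lra.
rewrite mult_INR /= -e; move: e ln0 dn; set x := log2 _ => e ln0 dn.
have x0 : 0 <= x by apply: Rnot_lt_le => x0; nra.
rewrite Rmult_1_l -[ln (1 + 1)]/(ln 2).
by apply: Rmult_le_compat_r; lra.
Qed.

(* 204 = 2 * 102, with the exponent 102 of [gate_code_count_le]. *)
Lemma code_count_sq N n L b : (2 <= N)%nat -> (b <= N ^ 102)%nat ->
  INR L <= 1 / 204 * INR n ^ 2 / log2 (INR N) -> ((b ^ L) ^ 2 <= 2 ^ (n * n))%nat.
Proof.
move=> N2 bN hL; have lg := log2_ge1 _ N2; have l2 := ln2_gt0.
apply: (@leq_trans (N ^ (102 * L * 2))).
  rewrite !expnM leq_exp2r //; case: (L) => // L'; by rewrite leq_exp2r.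
apply: expn_le_ln => //; first by lia.
have e : ln (INR N) = log2 (INR N) * ln 2 by rewrite /log2; field; lra.
rewrite e !mult_INR; move: lg hL; set x := log2 _ => lg hL.
have {}hL : INR L * x <= 1 / 204 * INR n ^ 2.
  have -> : 1 / 204 * INR n ^ 2 = 1 / 204 * INR n ^ 2 / x * x by field; lra.
  by apply: Rmult_le_compat_r; lra.
have -> : INR 102 = 102 by rewrite INR_IZR_INZ.
have -> : INR 2 = 2 by [].
have -> : 102 * INR L * 2 * (x * ln 2) = 204 * (INR L * x) * ln 2 by ring.
by rewrite -[IZR 2]/2; apply: Rmult_le_compat_r; lra.
Qed.

(** After squaring, (a + b)^2 <= 4 * 2^(n^2), and the exponents satisfy 2 + n^2 + 2n <= 2n(n-1). The
    factor 2^n is what makes the exceptional fraction vanish. *)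
Lemma negligible_sum n a b G : (6 <= n)%nat -> (a ^ 2 <= 2 ^ (n * n))%nat ->
  (b ^ 2 <= 2 ^ (n * n))%nat -> (2 ^ (n * (n - 1)) <= G)%nat -> ((a + b) * 2 ^ n <= G)%nat.
Proof.
move=> n6 ha hb; apply: leq_trans; rewrite -(leq_exp2r _ _ (isT : (0 < 2)%nat)) expnMn.
apply: (@leq_trans (2 ^ 2 * 2 ^ (n * n) * (2 ^ n) ^ 2)).
  rewrite leq_mul2r; apply/orP; right; move: ha hb; move: (2 ^ (n * n))%nat => p.
  by rewrite !expnS !expn0 !muln1; nia.
by rewrite -!expnM -!expnD leq_exp2l //; nia.
Qed.

(** * Combining the two bounds *)

Lemma pboolP P : reflect P (pbool P).
Proof. by rewrite /pbool; case: excluded_middle_informative => h; constructor. Qed.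

Lemma not_hard_depth eps c n m M : ~ hard eps c n m M ->
  exists Cc, [/\ wf_circuit (n + m) Cc, approximates n m Cc M eps
               & INR (depth Cc) < depth_bound c n m].
Proof.
move=> nh; apply: Classical_Prop.NNPP => none; apply: nh => Cc wf app.
by apply/Rle_ge/Rnot_lt_le => lt; apply: none; exists Cc.
Qed.

Lemma hard_fractionE eps c n m : (0 < n)%nat -> hard_fraction eps c n m =
  1 - INR #|[set M : 'M['F_2]_n | (M \in unitmx) && ~~ pbool (hard eps c n m M)]|
      / INR #|[set M : 'M['F_2]_n | M \in unitmx]|.
Proof.
move=> n0; rewrite /hard_fraction; set H := [set M | _ && pbool _]; set B := [set M | _ && ~~ _].
set G := [set M | _].
have G0 : 0 < INR #|G|.
  apply: lt_0_INR; have := card_unitmx_ge n n0; have := expn_gt0 2 (n * (n - 1)); rewrite -/G; lia.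
have eG : #|G| = (#|H| + #|B|)%nat.
  rewrite -(cardsID [set M | pbool (hard eps c n m M)] G); congr (_ + _)%nat.
    by apply: eq_card => M; rewrite !inE.
  by apply: eq_card => M; rewrite !inE andbC.
by rewrite eG plus_INR in G0 *; field; lra.
Qed.

(** Union bound over [A1], the matrices with all rows light, and [A2], those approximated with at
    most L gates. Which set catches a matrix that is not hard depends on the larger term of the
    maximum. *)
Lemma easy_count eps K0 n m : 0 < eps -> eps ^ 2 < 1 / 2 -> (0 < K0)%nat ->
  2 * eps + 12 / INR K0 < sqrt 2 -> (256 <= n)%nat -> (2 * K0 + 4 <= n)%nat ->
  (#|[set M : 'M['F_2]_n | (M \in unitmx) && ~~ pbool (hard eps (1 / 204) n m M)]| * 2 ^ n
   <= #|[set M : 'M['F_2]_n | M \in unitmx]|)%nat.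
Proof.
move=> eps0 eps2 K00 gap n256 Kn; have n0 : (0 < n)%nat by lia.
have N2 : (2 <= n + m)%nat by lia.
have N0 : 0 < INR (n + m) by apply: lt_0_INR; lia.
have n1 : 1 <= INR n by apply: (INR_leq 1).
have lg := log2_ge1 _ N2.
have [t [tn nt]] := exists_root4 n.
have bound0 : 0 <= 1 / 204 * INR n ^ 2 / log2 (INR (n + m)).
  by apply: Rmult_le_pos; [nra|apply: Rlt_le; apply: Rinv_0_lt_compat; lra].
(* A circuit of depth below the second term has at most depth * (n + m) gates; the factor n + m
   cancels, leaving this bound. *)
have [L [L_le L_max]] := exists_floor _ bound0.
pose A1 := [set M : 'M['F_2]_n | [forall i, (#|[set j | M i j != GRing.zero]| <= t)%nat]].
pose A2 := [set M : 'M['F_2]_n | pbool (exists Cc, [/\ wf_circuit (n + m) Cc,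
   approximates n m Cc M eps & (length (List.concat Cc) <= L)%nat])].
apply: (@leq_trans ((#|A1| + #|A2|) * 2 ^ n)%nat).
  rewrite leq_mul2r; apply/orP; right; apply: leq_trans (leq_card_setU A1 A2).
  apply: subset_leq_card; apply/subsetP => M; rewrite !inE => /andP [_ /pboolP/not_hard_depth].
  move=> [Cc [wf app]]; rewrite /depth_bound /Rmax; case: Rle_dec => _ d_lt; apply/orP.
    right; apply/pboolP; exists Cc; split => //; apply: L_max.
    apply: (Rle_trans _ (INR (depth Cc) * INR (n + m))).
      by rewrite -mult_INR; apply: INR_leq; apply: length_circuit.
    apply: (Rle_trans _ (1 / 204 * (INR n ^ 2 / (INR (n + m) * log2 (INR (n + m)))) * INR (n + m))).
      by apply: Rmult_le_compat_r; lra.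
    by apply: Req_le; field; lra.
  left; apply/forallP => i; apply: leq_trans (row_weight_le _ _ _ _ _ i eps0 eps2 wf app) _.
  exact: (small_depth_lightcone n).
apply: negligible_sum (card_unitmx_ge n n0); first by lia.
  apply: leq_trans (low_weight_count_sq n t n256 tn nt).
  by rewrite leq_exp2r //; apply: card_low_weight_matrices.
have L_n : INR L <= INR n ^ 2.
  apply: Rle_trans L_le _; apply: (Rmult_le_reg_r (log2 (INR (n + m)))); first lra.
  rewrite /Rdiv Rmult_assoc Rinv_l; last lra.
  by have := pow2_ge_0 (INR n); nra.
have k0 : 0 < INR K0 by apply: lt_0_INR; lia.
have K_pos : (0 < K0 * (n * n))%nat by rewrite !muln_gt0 K00 n0.
apply: leq_trans (code_count_sq (n + m) n L _ N2 (gate_code_count_le (n + m) K0 n (leq_addr _ _) _) L_le).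
  rewrite leq_exp2r //; apply: (card_approximable n m eps) => //.
    (* With K = K0 n^2 and L + 1 <= 2 n^2, the rounding error is at most 12 / K0. *)
    apply: Rle_lt_trans gap; apply: Rplus_le_compat_l.
    rewrite !mult_INR; have nn0 : 0 < INR n * INR n by nra.
    apply: (Rmult_le_reg_r (INR K0 * (INR n * INR n))); first exact: Rmult_lt_0_compat.
    have -> : 12 / INR K0 * (INR K0 * (INR n * INR n)) = 12 * (INR n * INR n) by field; lra.
    have -> : (INR L + 1) * (6 * / (INR K0 * (INR n * INR n))) * (INR K0 * (INR n * INR n))
       = 6 * (INR L + 1) by field; split; lra.
    by nra.
  by move=> M; rewrite inE => /pboolP.
by lia.
Qed.

Theorem theorem2 :
  forall eps : R, (0 < eps)%R -> (eps < sqrt 2 / 2)%R ->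
  exists c : R, (0 < c)%R /\
    forall m : nat -> nat,
      Un_cv (fun n => hard_fraction eps c n (m n)) 1%R.
Proof.
move=> eps eps0 eps_lt; exists (1 / 204); split; first lra.
move=> m e e0.
have s2 : sqrt 2 * sqrt 2 = 2 by apply: sqrt_sqrt; lra.
have eps2 : eps ^ 2 < 1 / 2 by nra.
have gap0 : 0 < sqrt 2 - 2 * eps by lra.
(* K0 makes 12 / K0 smaller than the gap sqrt 2 - 2 eps. *)
have [K0 [hK0 K00]] := archimed_cor1 ((sqrt 2 - 2 * eps) / 12) ltac:(lra).
(* The exceptional fraction is at most 2^(-n) <= 1/k < e once n >= k. *)
have [k [hk k0]] := archimed_cor1 e e0.
exists (256 + (2 * K0 + 4) + k)%nat => n hn.
have n0 : (0 < n)%nat by lia.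
have := easy_count eps K0 n (m n) eps0 eps2 _ _ _ _; rewrite hard_fractionE //.
set B := #|[set M | _ && _]|; set G := #|_| => count.
have {}count : (B * 2 ^ n <= G)%nat by apply: count; [lia|rewrite /Rdiv; lra|lia|lia].
have G0 : 0 < INR G.
  apply: lt_0_INR; have := card_unitmx_ge n n0; have := expn_gt0 2 (n * (n - 1)); rewrite -/G; lia.
have B0 := pos_INR B.
have kn : (k <= 2 ^ n)%nat by apply: leq_trans (ltnW (ltn_expl n _)) => //; lia.
have Bk : INR B * INR k <= INR G.
  by rewrite -mult_INR; apply: INR_leq; apply: leq_trans count; rewrite leq_mul2l kn orbT.
have kpos : 0 < INR k by apply: lt_0_INR; lia.
rewrite /R_dist (_ : 1 - INR B / INR G - 1 = - (INR B / INR G)); last ring.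
rewrite Rabs_Ropp Rabs_pos_eq; last by apply: Rmult_le_pos => //; apply: Rlt_le; apply: Rinv_0_lt_compat.
apply: Rle_lt_trans hk; apply: (Rmult_le_reg_r (INR G * INR k)); first nra.
have -> : INR B / INR G * (INR G * INR k) = INR B * INR k by field; lra.
by have -> : / INR k * (INR G * INR k) = INR G by field; lra.
Qed.
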